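(* Let $H$ be a connected hypergraph with maximum degree $\Delta$. Then $\rho(\mathcal{A}_H)\leqslant\Delta$, with equality if and only if $H$ is regular.
   Context: A (finite) hypergraph $H$ has vertex set $V(H)$ and edge set $E(H)$, a set of nonempty subsets of $V(H)$, with at least one edge (so that the rank is defined). The degree $d_i$ of a vertex $i$ is the number of edges containing $i$; $\Delta=\max_i d_i$; $H$ is regular if all vertices have the same degree. The rank $r(H)$ is the maximum cardinality of an edge. A path of length $l$ is an alternating sequence $u_1e_1u_2\cdots u_le_lu_{l+1}$ with distinct vertices $u_1,\ldots,u_{l+1}$ and distinct edges $e_1,\ldots,e_l$ such that $u_i,u_{i+1}\in e_i$ for all $i$; $H$ is connected if there is a path between any two vertices. The adjacency tensor $\mathcal{A}_H=(a_{i_1\cdots i_k})$ of a hypergraph $H$ with $r(H)=k$ is the order $k$, dimension $|V(H)|$ symmetric tensor with $a_{i_1\cdots i_k}=\frac{1}{(k-1)!}$ if $\{i_1,\ldots,i_k\}$ is an edge of cardinality $k$; $a_{i_1\cdots i_k}=\frac{(k-s+1)!}{k!}$ if, as a multiset, $\{i_1,\ldots,i_k\}$ consists of $j_1$ with multiplicity $k-s+1$ and $j_2,\ldots,j_s$ each with multiplicity one, for some edge $\{j_1,\ldots,j_s\}\in E(H)$ of cardinality $s<k$ (any element of the edge may play the role of $j_1$); and $a_{i_1\cdots i_k}=0$ otherwise. For an order $m$ dimension $n$ tensor $\mathcal{A}=(a_{i_1\cdots i_m})$ and $x\in\mathbb{C}^n$, $\mathcal{A}x^{m-1}\in\mathbb{C}^n$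 has $i$-th component $\sum_{i_2,\ldots,i_m=1}^n a_{ii_2\cdots i_m}x_{i_2}\cdots x_{i_m}$. A number $\lambda\in\mathbb{C}$ is an eigenvalue of $\mathcal{A}$ if $\mathcal{A}x^{m-1}=\lambda x^{[m-1]}$ for some nonzero $x\in\mathbb{C}^n$, where $x^{[m-1]}=(x_1^{m-1},\ldots,x_n^{m-1})^{\mathrm T}$. The spectral radius is $\rho(\mathcal{A})=\max\{|\lambda|:\lambda \text{ an eigenvalue of }\mathcal{A}\}$. *)

(* Defs.v *)
From mathcomp Require Import boolp classical_sets reals.
From mathcomp Require Import all_boot all_order all_algebra.
From mathcomp Require Import complex.

Set Implicit Arguments.
Unset Strict Implicit.
Unset Printing Implicit Defensive.

Import Order.TTheory GRing.Theory Num.Theory.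
Local Open Scope ring_scope.

Record hypergraph (V : finType) := Hypergraph {
  edges : {set {set V}};
  edges_nonempty : set0 \notin edges;
  edges_exist : edges != set0 }.

Section HypergraphDefs.
Context (V : finType) (H : hypergraph V).

Definition hdegree (i : V) : nat := #|[set e in edges H | i \in e]|.

Definition max_hdegree : nat := \max_(i : V) hdegree i.

Definition hrank : nat := \max_(e in edges H) #|e|.

Definition hregular : Prop := forall i j : V, hdegree i = hdegree j.

(* The alternating sequence u_1 e_1 u_2 ... e_l u_(l+1) is encoded as its first
   vertex u_1 together with the list [:: (e_1, u_2); ...; (e_l, u_(l+1))]. *)
Fixpoint walk (u : V) (p : seq ({set V} * V)) : bool :=
  if p is (e, v) :: p' then
    [&& e \in edges H, u \in e, v \in e & walk v p']
  else true.

Definition hyperpath (u : V) (p : seq ({set V} * V)) : bool :=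
  [&& walk u p, uniq (u :: unzip2 p) & uniq (unzip1 p)].

Definition hconnected : Prop :=
  forall u v : V, exists2 p, hyperpath u p & last u (unzip2 p) = v.

End HypergraphDefs.

(* A complex tensor of order m whose indices range over V, hence of
   dimension #|V|. *)
Definition tensor (R : realType) (m : nat) (V : finType) :=
  m.-tuple V -> R[i].

Section TensorDefs.
Context (R : realType) (m : nat) (V : finType).
Implicit Types (A : tensor R m V) (x : {ffun V -> R[i]}).

(* The i-th component of A x^(m-1): the sum runs over the index tuples
   (i_1, ..., i_m) with i_1 = i. *)
Definition tensor_apply A x (i : V) : R[i] :=
  \sum_(t : m.-tuple V | ohead t == Some i) A t * \prod_(j <- behead t) x j.

Definition tensor_eigenvalue A (lam : R[i]) : Prop :=
  exists2 x : {ffun V -> R[i]}, x != 0 &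
    forall i : V, tensor_apply A x i = lam * x i ^+ m.-1.

Definition eigenvalue_moduli A : set R :=
  [set ComplexField.Normc.normc lam | lam in tensor_eigenvalue A]%classic.

(* The maximum is written as a supremum to get a total function; see
   spectral_radius_max. *)
Definition spectral_radius A : R := sup (eigenvalue_moduli A).

Lemma spectral_radius_max A (r : R) :
  eigenvalue_moduli A r -> ubound (eigenvalue_moduli A) r ->
  spectral_radius A = r.
Proof.
move=> Ar ubr; apply/eqP; rewrite eq_le; apply/andP; split.
  by apply: ge_sup => //; exists r.
by apply: ub_le_sup => //; exists r.
Qed.

End TensorDefs.

(* If the indices of t form the multiset described in either nonzero case, then
   the edge in question is the support e of t. *)
Definition adjacency_tensor (R : realType) (V : finType) (H : hypergraph V) :
    tensor R (hrank H) V := fun t =>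
  let k := hrank H in
  let e := [set i in t] in
  let s := #|e| in
  if e \notin edges H then 0
  else if s == k then ((k.-1)`!%:R)^-1
  else if [exists j1 in e, (count_mem j1 t == (k - s).+1) &&
                           [forall j in e :\ j1, count_mem j t == 1%N]]
  then ((k - s).+1)`!%:R / (k`!)%:R
  else 0.
Arguments adjacency_tensor R {V} H t.

(* Main.v *)
Require Import Defs.
From mathcomp Require Import boolp classical_sets reals.
From mathcomp Require Import all_boot all_order all_algebra.
From mathcomp Require Import complex lra.

Set Implicit Arguments.
Unset Strict Implicit.
Unset Printing Implicit Defensive.

Import Order.TTheory GRing.Theory Num.Theory.
Local Open Scope ring_scope.

(** Write [A] for the adjacency tensor, [k] for the rank and [Delta] for the
    maximum degree.

    The entries of [A] are scaled so that row [i] sums to the degree of [i]: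
    every edge [e] through [i] contributes exactly 1.  To see this, read both
    nonzero cases of the definition uniformly: [A t] is the sum, over the edges
    [e] and the vertices [j] of [e], of [(k - |e| + 1)! / k!] if [t] is an
    arrangement of the word listing [e] once together with [k - |e|] further
    copies of [j] ([adjacency_tensorE]).  For [|e| = k] the [k] words coincide
    and the terms add up to [k / k! = 1 / (k-1)!].  Counting arrangements with a
    given first letter by the multinomial formula, the pair [(e, j)] contributes
    [(1 + [i = j] (k - |e|)) / k] to row [i], which sums to 1 over [j] in [e]
    ([edge_word_head_weight]).

    The upper bound is the Collatz-Wielandt inequality for nonnegative tensors:
    if [y > 0] and [A y^(k-1) <= c y^[k-1]] componentwise, then every eigenvalue
    has modulus at most [c] ([collatz_wielandt]).  Taking [y = 1] gives
    [c = Delta].  If [H] is regular, the all-ones vector is an eigenvector for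
    [Delta], so the bound is attained.

    If [H] is not regular, some vertex [v0] has degree below [Delta], and a
    vector [y] with [A y^(k-1) < Delta y^[k-1]] in every component shows that all
    moduli are at most one constant [c < Delta] ([moduli_lt_max_hdegree]); this
    also excludes that the supremum of the moduli is [Delta] without being
    attained.  The vector is [y i = 1 - delta^(D i + 1)], where [D i] is the
    length of a shortest walk from [i] to [v0].  At [v0] there is slack because
    the degree is too small.  A vertex [i <> v0] has a neighbour [j] closer to
    [v0]; lowering [y j] below 1 decreases the [i]-th component on the left by
    an amount of order [delta^(D i)], whereas the right-hand side decreases only
    by an amount of order [delta^(D i + 1)] ([strict_test_vector]). *)

(** * Counting the arrangements of a word *)

Lemma big_tuple_head (V : finType) (S : Type) (idx : S)
    (op : Monoid.com_law idx) (m : nat) (i : V) (F : seq V -> S) :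
  \big[op/idx]_(t : m.+1.-tuple V | ohead t == Some i) F t =
  \big[op/idx]_(u : m.-tuple V) F (i :: u).
Proof.
rewrite (reindex_onto (cons_tuple i) (fun t => [tuple of behead t])) /=.
  apply: eq_bigl => u; rewrite eqxx /=.
  by apply/eqP/val_inj.
move=> t /eqP ti; apply: val_inj => /=.
by case/tupleP: t ti => j u /= [->].
Qed.

(** The denominator of the multinomial coefficient counting the arrangements of
    the word [w]. *)
Definition multiplicity_fact (V : finType) (w : seq V) : nat :=
  (\prod_(x : V) (count_mem x w)`!)%N.

Lemma multiplicity_fact_rem (V : finType) (i : V) (w : seq V) : i \in w ->
  (multiplicity_fact w = count_mem i w * multiplicity_fact (rem i w))%N.
Proof.
move=> iw; rewrite /multiplicity_fact (bigD1 i) //= [in RHS](bigD1 i) //= mulnA.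
rewrite count_mem_rem eqxx subn1; congr (_ * _)%N.
  have : (0 < count_mem i w)%N by rewrite -has_count has_pred1.
  by case: (count_mem i w) => // n _; rewrite factS.
apply: eq_bigr => j ji; rewrite count_mem_rem eq_sym (negPf ji).
by rewrite subn0.
Qed.

(** The arrangements of [w] that start with [i] are those of [w] with one [i]
    removed; this is the induction step of the multinomial formula. *)
Lemma multinomial_head_step (V : finType) (m : nat) (w : seq V) (i : V) :
  (forall w' : seq V, size w' = m ->
   (\sum_(t : m.-tuple V) perm_eq t w' * multiplicity_fact w' = m`!)%N) ->
  size w = m.+1 ->
  (\sum_(t : m.+1.-tuple V | ohead t == Some i) perm_eq t w *
     multiplicity_fact w = count_mem i w * m`!)%N.
Proof.
move=> IH szw.
rewrite (big_tuple_head _ m i (fun t => perm_eq t w * multiplicity_fact w)%N).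
have [iw|niw] := boolP (i \in w); last first.
  rewrite (count_memPn niw) mul0n big1 // => u _.
  case: (boolP (perm_eq _ _)) => // /perm_mem/(_ i).
  by rewrite mem_head (negPf niw).
rewrite -(IH (rem i w)); last by rewrite size_rem // szw.
rewrite (multiplicity_fact_rem iw) big_distrr /=; apply: eq_bigr => u _.
rewrite mulnCA; congr (_ * (nat_of_bool _ * _))%N.
by rewrite (permPr (perm_to_rem iw)) perm_cons.
Qed.

(** Sorting the arrangements of [w] by their first letter, each letter [i]
    accounts for a share [count_mem i w * m`!] of [m.+1`!], and the
    multiplicities add up to [m.+1]. *)
Lemma multinomial_count (V : finType) (m : nat) (w : seq V) : size w = m ->
  (\sum_(t : m.-tuple V) perm_eq t w * multiplicity_fact w = m`!)%N.
Proof.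
elim: m w => [|m IH] w szw.
  rewrite (size0nil szw) (big_pred1 [tuple]) => [|t]; last first.
    by rewrite [t]tuple0; apply/esym/eqP.
  by rewrite /multiplicity_fact big1.
rewrite (partition_big (fun t : m.+1.-tuple V => thead t) predT) //=.
under eq_bigr => i _.
  rewrite (eq_bigl (fun t : m.+1.-tuple V => ohead t == Some i)); last first.
    by move=> t; case/tupleP: t => j u; rewrite theadE.
  rewrite (multinomial_head_step i IH szw); over.
rewrite -big_distrl /= factS; congr (_ * _)%N.
rewrite -szw; elim: w {szw} => [|x w IHw] /=; first by rewrite big1.
rewrite big_split /= IHw (bigD1 x) //= eqxx big1 // => y /negPf yx.
by rewrite eq_sym yx.
Qed.

Lemma multinomial_head_count (V : finType) (m : nat) (w : seq V) (i : V) :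
  size w = m.+1 ->
  (\sum_(t : m.+1.-tuple V | ohead t == Some i) perm_eq t w *
     multiplicity_fact w = count_mem i w * m`!)%N.
Proof. exact: multinomial_head_step (@multinomial_count V m). Qed.

(** * The words of an edge *)

(** The index multisets of the nonzero tensor entries belonging to [e]: each
    vertex of [e] once, and enough extra copies of one vertex [j] to reach
    length [k].  For [#|e| = k] all choices of [j] give the same word. *)
Definition edge_word (V : finType) (k : nat) (e : {set V}) (j : V) : seq V :=
  nseq (k - #|e|) j ++ enum e.

Section EdgeWord.
Context (V : finType) (k : nat) (e : {set V}).
Context (e_le : (#|e| <= k)%N).
Implicit Types i j : V.

Lemma size_edge_word j : size (edge_word k e j) = k.
Proof. by rewrite size_cat size_nseq -cardE subnK. Qed.

Lemma mem_edge_word j : j \in e -> edge_word k e j =i e.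
Proof.
move=> je i; rewrite mem_cat mem_nseq mem_enum orbC.
by case: (boolP (i \in e)) => //= ie; case: eqP ie => [->|]; rewrite ?je ?andbF.
Qed.

Lemma count_edge_word i j :
  count_mem i (edge_word k e j) = ((j == i) * (k - #|e|) + (i \in e))%N.
Proof.
by rewrite count_cat count_nseq count_uniq_mem ?enum_uniq // mem_enum.
Qed.

Lemma multiplicity_fact_edge_word j : j \in e ->
  multiplicity_fact (edge_word k e j) = ((k - #|e|).+1)`!.
Proof.
move=> je; rewrite /multiplicity_fact (bigD1 j) //= big1 => [|i ij].
  by rewrite count_edge_word je eqxx mul1n addn1 muln1.
by rewrite count_edge_word eq_sym (negPf ij); case: (_ \in _).
Qed.

(** An edge contributes 1 to the row sum of each of its vertices.  For each [j],
    the multinomial count of arrangements starting with [i] has denominator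
    [(k - #|e|).+1`!], which cancels against the entry; what remains is the
    multiplicity of [i] in the word divided by [k], and these multiplicities
    add up to [k] over [j] in [e]. *)
Lemma edge_word_head_weight (R : numFieldType) i : i \in e ->
  \sum_(t : k.-tuple V | ohead t == Some i) \sum_(j in e)
     (perm_eq t (edge_word k e j))%:R * ((k - #|e|).+1`!%:R / k`!%:R) = 1 :> R.
Proof.
move=> ie; have e_gt0 : (0 < #|e|)%N by apply/card_gt0P; exists i.
case Ek: k e_le => [|m] le_em; first by case: #|e| e_gt0 le_em.
have fact_neq0 n : n`!%:R != 0 :> R by rewrite pnatr_eq0 -lt0n fact_gt0.
have count_word j : j \in e -> \sum_(t : m.+1.-tuple V | ohead t == Some i)
    (perm_eq t (edge_word m.+1 e j))%:R * (m.+1 - #|e|).+1`!%:R =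
    ((j == i) * (m.+1 - #|e|) + 1)%:R * m`!%:R :> R.
  move=> je; have szw : size (edge_word m.+1 e j) = m.+1.
    by rewrite -Ek size_edge_word.
  have := multinomial_head_count i szw.
  rewrite -Ek multiplicity_fact_edge_word // count_edge_word ie Ek.
  move/(congr1 (GRing.natmul (1 : R))); rewrite natrM natr_sum => <-.
  by apply: eq_bigr => t _; rewrite natrM.
rewrite exchange_big /=.
under eq_bigr => j je.
  under eq_bigr do rewrite mulrA.
  rewrite -mulr_suml count_word //.
  over.
rewrite -mulr_suml -mulr_suml -natr_sum big_split /= sum1_card.
rewrite (bigD1 i) //= eqxx mul1n big1 => [|j /andP[_ /negPf ->] //].
by rewrite addn0 subnK // -natrM -factS divff.
Qed.

End EdgeWord.

(** * The adjacency tensor as a sum over edges *)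

(** The entries of the adjacency tensor as real numbers, with the full and the
    small edges treated by the same formula. *)
Definition adjacency_weight (R : realType) (V : finType) (H : hypergraph V)
    (t : seq V) : R :=
  \sum_(e in edges H) \sum_(j in e)
    (perm_eq t (edge_word (hrank H) e j))%:R *
    ((hrank H - #|e|).+1`!%:R / (hrank H)`!%:R).

Section AdjacencyWeight.
Context (R : realType) (V : finType) (H : hypergraph V).
Let k := hrank H.
Implicit Types (e : {set V}) (i j : V) (t : k.-tuple V).

Lemma leq_card_hrank e : e \in edges H -> (#|e| <= k)%N.
Proof. by move=> eH; rewrite /k /hrank (bigD1 e) //= leq_maxl. Qed.

Lemma edge_card_gt0 e : e \in edges H -> (0 < #|e|)%N.
Proof.
move=> eH; rewrite card_gt0; apply: contraTneq eH => ->.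
exact: edges_nonempty.
Qed.

(** The support of an index tuple determines the edge, so at most one edge
    contributes to each entry. *)
Lemma perm_edge_word_support (t : seq V) e j : j \in e ->
  perm_eq t (edge_word k e j) -> [set i in t] = e.
Proof.
move=> je /perm_mem tw; apply/setP => i.
by rewrite inE tw mem_edge_word.
Qed.

Lemma perm_edge_word_full t : #|[set i in t]| = k ->
  forall j, perm_eq t (edge_word k [set i in t] j).
Proof.
move=> card_e j; rewrite /edge_word card_e subnn /=.
apply: uniq_perm (enum_uniq _) _; last by move=> i; rewrite mem_enum inE.
by apply/card_uniqP; rewrite size_tuple -{2}card_e cardsE.
Qed.

Lemma perm_edge_wordE t j : let e := [set i in t] in
  j \in e -> (#|e| < k)%N ->
  perm_eq t (edge_word k e j) =
    (count_mem j t == (k - #|e|).+1) &&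
    [forall i in e :\ j, count_mem i t == 1%N].
Proof.
move=> e je e_lt; apply/idP/andP => [/permP tw|[/eqP tj /forall_inP ti]].
  rewrite tw count_edge_word eqxx je mul1n addn1; split => //.
  apply/forall_inP => i; rewrite !inE => /andP[ij it].
  by rewrite tw count_edge_word [j == i]eq_sym (negPf ij) inE it.
apply/allP => i _ /=; apply/eqP; rewrite count_edge_word.
have [<-|ji] := eqVneq j i; first by rewrite tj je mul1n addn1.
case: (boolP (i \in e)) => [ie|nie].
  by apply/eqP/ti; rewrite !inE eq_sym ji; rewrite inE in ie.
by apply/count_memPn; rewrite inE in nie.
Qed.

Lemma adjacency_tensorE t :
  adjacency_tensor R H t = ((adjacency_weight R H t)%:C)%C.
Proof.
rewrite /adjacency_tensor -/k; set e := [set i in t]; rewrite /adjacency_weight -/k.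
have other e' : e' != e -> \sum_(j in e') (perm_eq t (edge_word k e' j))%:R *
    ((k - #|e'|).+1`!%:R / k`!%:R) = 0 :> R.
  move=> ne; apply: big1 => j je'.
  case: (boolP (perm_eq _ _)) => [/(perm_edge_word_support je')/esym/eqP|].
    by rewrite (negPf ne).
  by rewrite mul0r.
case: ifPn => [eH|].
  rewrite big1 // => e' e'H; apply: other.
  by apply: contraNneq eH => <-.
rewrite negbK => eH; rewrite (bigD1 e) //= [X in _ + X]big1 ?addr0; last first.
  by move=> e' /andP[_]; apply: other.
case: ifPn => [/eqP card_e|card_e].
  (* All k words of a full edge coincide, hence k equal terms 1 / k!. *)
  have k_gt0 : (0 < k)%N by rewrite -card_e edge_card_gt0.
  under eq_bigr => j _ do rewrite perm_edge_word_full // mul1r.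
  rewrite sumr_const card_e subnn (_ : _ *+ k = (k.-1)`!%:R^-1).
    by rewrite fmorphV rmorph_nat.
  case: (k) k_gt0 => // n _.
  rewrite -[1`!]/1%N factS natrM mulr1n -[_ *+ n.+1]mulr_natr div1r invfM.
  by rewrite mulrAC mulVf ?mul1r ?pnatr_eq0.
have e_lt : (#|e| < k)%N by rewrite ltn_neqAle card_e leq_card_hrank.
under eq_bigr => j je do rewrite perm_edge_wordE //.
case: ifPn => [/exists_inP[j je jP]|none]; last first.
  rewrite big1 // => j je.
  case: (boolP (_ && _)) => [jP|_]; last by rewrite mul0r.
  by case/exists_inP: none; exists j.
(* The repeated vertex is unique: its multiplicity k - #|e| + 1 exceeds 1. *)
rewrite (bigD1 j) //= jP mul1r big1 => [|i /andP[ie ij]].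
  by rewrite addr0 fmorph_div !rmorph_nat.
case: (boolP (_ && _)) => [/andP[/eqP ti _]|]; last by rewrite mul0r.
case/andP: jP => _ /forall_inP/(_ i).
rewrite in_setD1 ij ie => /(_ isT); rewrite ti eqSS subn_eq0.
by rewrite leqNgt e_lt.
Qed.

Lemma adjacency_weight_ge0 (t : seq V) : 0 <= adjacency_weight R H t.
Proof. by do 2!apply: sumr_ge0 => ? _; rewrite mulr_ge0 ?divr_ge0. Qed.

Lemma adjacency_weight_row_sum i :
  \sum_(t : k.-tuple V | ohead t == Some i) adjacency_weight R H t =
  (hdegree H i)%:R.
Proof.
rewrite exchange_big /= /hdegree -sum1_card natr_sum.
rewrite [RHS](eq_bigl (fun e => (e \in edges H) && (i \in e))); last first.
  by move=> e; rewrite inE.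
rewrite [RHS]big_mkcondr /=; apply: eq_bigr => e eH.
case: ifPn => [ie|nie].
  by rewrite edge_word_head_weight ?leq_card_hrank.
rewrite big1 // => t /eqP ti; rewrite big1 // => j je.
case: (boolP (perm_eq _ _)) => [tw|]; last by rewrite mul0r.
have := perm_edge_word_support je tw => te.
move: nie; rewrite -te inE.
by case: (tval t) ti => //= u s [->]; rewrite mem_head.
Qed.

(** Two vertices of a common edge interact: some entry with first index [i] and
    [j] among the others is bounded below by a positive constant depending only
    on the rank.  Repeating [j], rather than [i], gives such an entry for full
    and small edges alike. *)
Lemma adjacent_tuple i j e : e \in edges H -> i \in e -> j \in e -> j != i ->
  exists t : k.-tuple V, [/\ ohead t = Some i, j \in behead t &
    k`!%:R^-1 <= adjacency_weight R H t].
Proof.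
move=> eH ie je ji; pose w := edge_word k e j.
have iw : i \in w by rewrite mem_edge_word.
have tw : perm_eq (i :: rem i w) w by rewrite perm_sym perm_to_rem.
have szt : size (i :: rem i w) == k.
  by rewrite (perm_size tw) size_edge_word ?leq_card_hrank.
exists (Tuple szt); split => //=.
  rewrite -has_pred1 has_count count_mem_rem eq_sym (negPf ji) subn0.
  by rewrite -has_count has_pred1 mem_edge_word.
rewrite /adjacency_weight (bigD1 e) //= (bigD1 j) //= -/k -/w tw mul1r -addrA.
apply: le_trans (_ : _ <= (k - #|e|).+1`!%:R / k`!%:R) _.
  by rewrite ler_peMl ?invr_ge0 // ler1n fact_gt0.
rewrite lerDl addr_ge0 //.
  by apply: sumr_ge0 => ? _; rewrite mulr_ge0 ?divr_ge0.
by do 2!apply: sumr_ge0 => ? _; rewrite mulr_ge0 ?divr_ge0.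
Qed.

End AdjacencyWeight.

(** * The Collatz-Wielandt bound for nonnegative tensors *)

Lemma complex_normE (R : realType) (z : R[i]) :
  `|z| = ((ComplexField.Normc.normc z)%:C)%C.
Proof. by []. Qed.

Section NonnegTensor.
Context (R : realType) (m : nat) (V : finType) (B : m.-tuple V -> R).
Context (B_ge0 : forall t, 0 <= B t).

Definition real_tensor_apply (y : V -> R) (i : V) : R :=
  \sum_(t : m.-tuple V | ohead t == Some i) B t * \prod_(j <- behead t) y j.

Lemma normc_tensor_apply_le (A : tensor R m V) (x : {ffun V -> R[i]}) i :
  (forall t, A t = ((B t)%:C)%C) ->
  ComplexField.Normc.normc (tensor_apply A x i) <=
    real_tensor_apply (fun j => ComplexField.Normc.normc (x j)) i.
Proof.
move=> AB; rewrite -lecR -complex_normE rmorph_sum.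
apply: le_trans (ler_norm_sum _ _ _) _; apply: ler_sum => t _.
rewrite normrM normr_prod AB ger0_norm ?lecR //.
by rewrite rmorphM rmorph_prod.
Qed.

Lemma real_tensor_apply_scale (y z : V -> R) (c : R) i :
  (forall j, 0 <= z j <= c * y j) ->
  real_tensor_apply z i <= c ^+ m.-1 * real_tensor_apply y i.
Proof.
move=> zy; rewrite /real_tensor_apply mulr_sumr; apply: ler_sum => t _.
rewrite mulrCA ler_wpM2l //.
have -> : c ^+ m.-1 * \prod_(j <- behead t) y j = \prod_(j <- behead t) (c * y j).
  rewrite big_split /= big_const_seq count_predT iter_mulr_1.
  by rewrite size_behead size_tuple.
by apply: ler_prod => j _; apply: zy.
Qed.

(** For an eigenvector [x], compare the two sides of the eigenvalue equation at
    an index [i] maximizing [|x i| / y i]: with [M] this maximum, [|x| <= M y]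
    everywhere with equality at [i], and the factor [M ^+ m.-1] cancels. *)
Lemma collatz_wielandt (A : tensor R m V) (y : V -> R) (c : R) :
  (forall t, A t = ((B t)%:C)%C) -> (forall i, 0 < y i) ->
  (forall i, real_tensor_apply y i <= c * y i ^+ m.-1) ->
  ubound (eigenvalue_moduli A) c.
Proof.
move=> AB y_gt0 Byc r [lam [x x_neq0 eig] <-] {r}.
pose z j := ComplexField.Normc.normc (x j).
have z_ge0 j : 0 <= z j by rewrite -lecR; apply: normr_ge0 (x j).
have [i0 xi0] : exists i, x i != 0.
  apply/existsP; apply: contraNT x_neq0 => /existsPn x0.
  by apply/eqP/ffunP => i; rewrite ffunE; apply/eqP/negPn/x0.
have [i _ i_max] := arg_maxP (fun j => z j / y j) (erefl : xpredT i0).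
set M := z i / y i in i_max.
have M_gt0 : 0 < M.
  apply: lt_le_trans (i_max i0 isT); rewrite divr_gt0 // lt_def z_ge0 andbT.
  by apply: contra xi0 => /eqP/ComplexField.Normc.eq0_normc/eqP.
have zM j : 0 <= z j <= M * y j.
  by rewrite z_ge0 /= -ler_pdivrMr //; apply: i_max.
have zi : z i = M * y i by rewrite divfK // gt_eqF.
have /= := normc_tensor_apply_le x i AB; rewrite eig.
move/le_trans/(_ (real_tensor_apply_scale i zM)) => bound.
have : M ^+ m.-1 * real_tensor_apply y i <= M ^+ m.-1 * (c * y i ^+ m.-1).
  by rewrite ler_wpM2l // exprn_ge0 // ltW.
move/(le_trans bound).
rewrite ComplexField.Normc.normcM mulrCA -exprMn -zi.
have -> : ComplexField.Normc.normc (x i ^+ m.-1) = z i ^+ m.-1.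
  by apply: complexI; rewrite rmorphXn; apply: (normrX m.-1 (x i)).
by rewrite ler_pM2r // exprn_gt0 // zi mulr_gt0.
Qed.

End NonnegTensor.

(** * The test vector of a nonregular hypergraph *)

(** The length of a shortest walk to [v0] drops by one along the first step of
    that walk. *)
Lemma descending_potential (V : finType) (H : hypergraph V) (v0 : V) :
  hconnected H -> exists D : V -> nat, forall i, i != v0 ->
    exists e j, [/\ e \in edges H, i \in e, j \in e & (D j < D i)%N].
Proof.
move=> Hconn; pose P i n := `[< exists p, [/\ walk H i p,
  last i (unzip2 p) = v0 & size p = n] >].
have exP i : exists n, P i n.
  have [p /andP[wp _] lp] := Hconn i v0.
  by exists (size p); apply/asboolP; exists p.
exists (fun i => ex_minn (exP i)) => i iv0.
case: (ex_minnP (exP i)) => n /asboolP[[|[e j] p] [/= wp lp szp] _].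
  by rewrite lp eqxx in iv0.
case/and4P: wp => eH ie je wp; exists e, j; split => //.
case: ex_minnP => n' _ /(_ (size p)) le_n'.
by rewrite -szp ltnS le_n' //; apply/asboolP; exists p.
Qed.

Lemma bernoulli_le (R : realFieldType) (z : R) (n : nat) :
  0 <= z <= 1 -> 1 - n%:R * z <= (1 - z) ^+ n.
Proof.
case/andP=> z0 z1; elim: n => [|n IHn]; first by rewrite mul0r subr0 expr0.
rewrite exprS; apply: le_trans (_ : (1 - z) * (1 - n%:R * z) <= _).
  have : 0 <= n%:R * z ^+ 2 by rewrite mulr_ge0 ?sqr_ge0.
  by rewrite -natr1; lra.
by rewrite ler_wpM2l // subr_ge0.
Qed.

Section AdjacencySpectrum.
Context (R : realType) (V : finType) (H : hypergraph V).
Let k := hrank H.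
Let Delta := max_hdegree H.
Let A := adjacency_tensor R H.
Let apply_adj := @real_tensor_apply R k V (adjacency_weight R H).

Lemma max_hdegree_gt0 : (0 < max_hdegree H)%N.
Proof.
have [e eH] := set0Pn _ (edges_exist H).
have [i ie] : exists i, i \in e by apply/card_gt0P/(edge_card_gt0 eH).
rewrite /max_hdegree (bigD1 i) //= leq_max; apply/orP; left.
by apply/card_gt0P; exists e; rewrite inE eH.
Qed.

Lemma apply_adj1 i : apply_adj (fun=> 1) i = (hdegree H i)%:R.
Proof.
rewrite -adjacency_weight_row_sum; apply: eq_bigr => t _.
by rewrite big1 ?mulr1.
Qed.

Lemma moduli_le_max_hdegree : ubound (eigenvalue_moduli A) Delta%:R.
Proof.
apply: (collatz_wielandt (@adjacency_weight_ge0 R V H) (y := fun=> 1)) => //.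
  exact: adjacency_tensorE.
move=> i; rewrite [real_tensor_apply _ _ _]apply_adj1 expr1n mulr1 ler_nat.
by rewrite /Delta /max_hdegree (bigD1 i) //= leq_maxl.
Qed.

(** Each monomial of row [i] is at most 1, and the one of [adjacent_tuple]
    contains the factor [y j]; its deficit [1 - y j] survives, weighted by the
    size of that entry. *)
Lemma apply_adj_gap (y : V -> R) i j e :
  (forall v, 0 <= y v <= 1) -> e \in edges H -> i \in e -> j \in e -> j != i ->
  apply_adj y i <= (hdegree H i)%:R - k`!%:R^-1 * (1 - y j).
Proof.
move=> y01 eH ie je ji.
have [t [ti jt wt]] := adjacent_tuple R eH ie je ji.
have prod_le1 (s : seq V) : \prod_(v <- s) y v <= 1 by apply: prodr_ile1.
rewrite lerBrDr -lerBrDl -adjacency_weight_row_sum -sumrB.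
rewrite (bigD1 t) ?ti //= -[leLHS]addr0 lerD //; last first.
  apply: sumr_ge0 => u _; rewrite subr_ge0 ler_piMr //.
  exact: adjacency_weight_ge0.
rewrite -[X in _ <= X - _]mulr1 -[leRHS]mulrBr ler_pM ?invr_ge0 //.
  by rewrite subr_ge0; case/andP: (y01 j).
rewrite lerD2l lerN2 (big_rem j jt) /=.
by rewrite ler_piMr //; case/andP: (y01 j).
Qed.

(** Being close to 1, [y] turns the power [k.-1] on the right into a linear loss
    by Bernoulli's inequality; [delta] is chosen so small that this loss, at most
    [Delta * k.-1 * delta ^+ (D i).+1], is beaten by the gain on the left, which
    is at least 1 at [v0] and [k`!^-1 * delta ^+ D i] elsewhere. *)
Lemma strict_test_vector v0 : hconnected H -> (hdegree H v0 < Delta)%N ->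
  exists2 y : V -> R, (forall i, 0 < y i) &
    (forall i, apply_adj y i < Delta%:R * y i ^+ k.-1).
Proof.
move=> Hconn v0_lt; have [D Dlt] := descending_potential v0 Hconn.
have De_gt0 : (0 : R) < Delta%:R by rewrite ltr0n max_hdegree_gt0.
pose alpha : R := k`!%:R^-1.
have alpha_gt0 : 0 < alpha by rewrite invr_gt0 ltr0n fact_gt0.
have alpha_le1 : alpha <= 1 by rewrite invf_le1 ?ltr0n ?ler1n fact_gt0.
pose N : R := Delta%:R * k.-1%:R.
have N_ge0 : 0 <= N by rewrite mulr_ge0.
pose delta := alpha / (N + 2).
have delta_gt0 : 0 < delta by rewrite divr_gt0 //; lra.
have Ndelta : N * delta < alpha.
  by rewrite mulrCA -[ltRHS]mulr1 ltr_pM2l // ltr_pdivrMr; lra.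
have delta_lt1 : delta < 1 by rewrite ltr_pdivrMr; lra.
have pow_gt0 n : 0 < delta ^+ n by rewrite exprn_gt0.
have pow_lt1 n : delta ^+ n.+1 < 1 by rewrite exprn_ilt1 // ltW.
pose y i := 1 - delta ^+ (D i).+1.
have y01 i : 0 <= y i <= 1.
  by rewrite subr_ge0 gerBl !ltW.
exists y => [i|i]; first by rewrite subr_gt0.
have lower : Delta%:R - N * delta ^+ (D i).+1 <= Delta%:R * y i ^+ k.-1.
  rewrite /N -mulrA -[X in X - _]mulr1 -mulrBr ler_pM2l //.
  by apply: bernoulli_le; rewrite !ltW.
apply: lt_le_trans lower.
have [->|iv0] := eqVneq i v0.
  have : apply_adj y v0 <= (hdegree H v0)%:R.
    rewrite -apply_adj1; apply: ler_sum => t _; rewrite ler_wpM2l //.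
      exact: adjacency_weight_ge0.
    by apply: ler_prod => j _; apply: y01.
  have : (hdegree H v0)%:R + 1 <= Delta%:R :> R by rewrite natr1 ler_nat.
  have : N * delta ^+ (D v0).+1 <= N * delta.
    by rewrite ler_wpM2l // exprS ler_piMr ?(ltW delta_gt0) // exprn_ile1 // ltW.
  lra.
have [e [j [eH ie je Dji]]] := Dlt i iv0.
have ji : j != i by apply: contraTneq Dji => ->; rewrite ltnn.
apply: le_lt_trans (apply_adj_gap y01 eH ie je ji) _.
have deg_le : (hdegree H i)%:R <= Delta%:R :> R.
  by rewrite ler_nat /Delta /max_hdegree (bigD1 i) //= leq_maxl.
have : N * delta ^+ (D i).+1 < alpha * (1 - y j).
  apply: lt_le_trans (_ : alpha * delta ^+ D i <= _).
    by rewrite exprS mulrA ltr_pM2r.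
  by rewrite ler_pM2l // /y subKr ler_wiXn2l // ltW.
rewrite -/alpha; lra.
Qed.

(** Since [V] is finite, strictness in every component leaves a uniform margin:
    [c] is the largest of the ratios in the Collatz-Wielandt bound. *)
Lemma moduli_lt_max_hdegree v0 : hconnected H -> (hdegree H v0 < Delta)%N ->
  exists2 c : R, c < Delta%:R & ubound (eigenvalue_moduli A) c.
Proof.
move=> Hconn v0_lt; have [y y_gt0 y_lt] := strict_test_vector Hconn v0_lt.
have [i _ i_max] := arg_maxP (fun j => apply_adj y j / y j ^+ k.-1)
  (erefl : xpredT v0).
have yk_gt0 j : 0 < y j ^+ k.-1 by rewrite exprn_gt0.
exists (apply_adj y i / y i ^+ k.-1); first by rewrite ltr_pdivrMr.
apply: (collatz_wielandt (@adjacency_weight_ge0 R V H) (y := y)) => //.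
  exact: adjacency_tensorE.
by move=> j; rewrite -ler_pdivrMr //; apply: i_max.
Qed.

Lemma max_hdegree_modulus : hregular H -> eigenvalue_moduli A Delta%:R.
Proof.
move=> reg; have deg i : hdegree H i = Delta.
  apply/eqP; rewrite eqn_leq {1}/Delta /max_hdegree (bigD1 i) //= leq_maxl.
  by apply/bigmax_leqP => j _; rewrite (reg j i).
exists (Delta%:R); last first.
  by apply: complexI; rewrite rmorph_nat; apply: (normr_nat R[i] Delta).
have [i0 _] : exists i : V, hdegree H i != 0%N.
  apply/existsP; have := max_hdegree_gt0; apply: contraLR => /existsPn deg0.
  rewrite -leqNgt; apply/bigmax_leqP => i _; rewrite leqn0.
  exact/negPn/deg0.
exists [ffun=> 1].
  by apply/eqP => /ffunP/(_ i0); rewrite !ffunE => /eqP; rewrite oner_eq0.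
move=> i; rewrite ffunE expr1n mulr1 -(deg i).
rewrite -[RHS](rmorph_nat (real_complex R)) -apply_adj1 rmorph_sum.
apply: eq_bigr => t _; rewrite [A t]adjacency_tensorE !big1 ?mulr1 //.
by move=> j _; rewrite ffunE.
Qed.

End AdjacencySpectrum.

(** * The spectral radius and the maximum degree *)

Theorem theorem3p4 (R : realType) (V : finType) (H : hypergraph V)
    (Hconn : hconnected H) :
  spectral_radius (adjacency_tensor R H) <= (max_hdegree H)%:R /\
  (spectral_radius (adjacency_tensor R H) = (max_hdegree H)%:R <-> hregular H).
Proof.
(* The supremum of an empty set is 0, hence the condition on c. *)
have sup_le (c : R) : 0 <= c ->
    ubound (eigenvalue_moduli (adjacency_tensor R H)) c ->
    spectral_radius (adjacency_tensor R H) <= c.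
  move=> c_ge0 ubc; rewrite /spectral_radius.
  have [->|/classical_sets.set0P ne] :=
      eqVneq (eigenvalue_moduli (adjacency_tensor R H)) classical_sets.set0.
    by rewrite sup0.
  exact: ge_sup.
split; first by apply: sup_le => //; apply: moduli_le_max_hdegree.
split=> [sup_eq|reg]; last first.
  apply: spectral_radius_max; first exact: max_hdegree_modulus.
  exact: moduli_le_max_hdegree.
suff deg i : hdegree H i = max_hdegree H by move=> i j; rewrite !deg.
apply/eqP; rewrite eqn_leq {1}/max_hdegree (bigD1 i) //= leq_maxl /= leqNgt.
apply/negP => /(moduli_lt_max_hdegree R Hconn)[c c_lt ubc].
have := sup_le (Num.max c 0); rewrite le_max lexx orbT => /(_ isT).
rewrite sup_eq => le_max; have : (max_hdegree H)%:R <= Num.max c 0.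
  by apply: le_max => r /ubc; rewrite Order.TotalTheory.le_max => ->.
by rewrite Order.TotalTheory.le_max leNgt c_lt lern0 -leqn0 leqNgt max_hdegree_gt0.
Qed.
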